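(* Let $X$ be a non-negative absolutely continuous random variable with probability density function $f$, let $\omega\ge0$ be a weight function, $\alpha>0$ and $\beta\ge1$. Then the GWIGF of the escort random variable $X_{e,\alpha}$ of order $\alpha$ is $$I_\beta^\omega(X_{e,\alpha})=\frac{I_{\alpha\beta}^\omega(X)}{\big(I_\alpha(X)\big)^\beta}.$$
   Context: For a non-negative absolutely continuous random variable $X$ with density $f$, a measurable weight $\omega\ge0$ and an order $p>0$, write $I_p^\omega(X)=\int_0^\infty\omega(u)f^p(u)\,du$ (general weighted information generating function, GWIGF) and $I_p(X)=\int_0^\infty f^p(u)\,du$ (information generating function). The escort random variable $X_{e,\alpha}$ of order $\alpha>0$ with baseline density $f$ is the random variable with density $f_{e,\alpha}(u)=f^\alpha(u)\big/\int_0^\infty f^\alpha(v)\,dv$, $u>0$. All integrals are assumed to exist (be finite). *)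

(* Defs.v *)
From HB Require Import structures.
From mathcomp Require Import all_boot all_order all_algebra.
From mathcomp Require Import all_classical all_reals all_analysis.
Set Implicit Arguments.
Unset Strict Implicit.
Unset Printing Implicit Defensive.
Import Order.TTheory GRing.Theory Num.Theory.
Import numFieldNormedType.Exports.
Local Open Scope classical_set_scope.
Local Open Scope ring_scope.
Local Open Scope ereal_scope.

Section generating_functions.
Context {R : realType}.
Local Notation mu := (@lebesgue_measure R).

Definition has_density {d : measure_display} {T : measurableType d}
    (P : probability T R) (X : {RV P >-> R}) (f : R -> R) : Prop :=
  [/\ measurable_fun [set: R] f,
      forall u, (0 <= f u)%R &
      forall A : set R, measurable A ->
        distribution P X A = \int[mu]_(u in A) (f u)%:E].

(* A chosen density. Two densities of X agree Lebesgue-a.e., so the integrals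
   below do not depend on the choice; the default value is only taken when X is
   not absolutely continuous. *)
Definition pdf {d : measure_display} {T : measurableType d}
    (P : probability T R) (X : {RV P >-> R}) : R -> R :=
  xget (cst 0%R) [set f | has_density X f].

Definition gwigf {d : measure_display} {T : measurableType d}
    (P : probability T R) (X : {RV P >-> R}) (w : R -> R) (p : R) : \bar R :=
  \int[mu]_(u in `]0%R, +oo[) (w u * pdf X u `^ p)%:E.

Definition igf {d : measure_display} {T : measurableType d}
    (P : probability T R) (X : {RV P >-> R}) (p : R) : \bar R :=
  \int[mu]_(u in `]0%R, +oo[) (pdf X u `^ p)%:E.

(* The density of the escort variable lives on u > 0: it is extended by 0. *)
Definition escort_density (f : R -> R) (a : R) (u : R) : R :=
  if (0 < u)%R
  then (f u `^ a / fine (\int[mu]_(v in `]0%R, +oo[) (f v `^ a)%:E))%R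
  else 0%R.

Definition is_escort {d : measure_display} {T : measurableType d}
    (P : probability T R) (Y : {RV P >-> R}) (f : R -> R) (a : R) : Prop :=
  has_density Y (escort_density f a).

End generating_functions.

(* Main.v *)
(* Densities of a random variable agree almost everywhere, so both generating
   functions can be computed with f and with its escort density f^a / c, where
   c = I_a(X); then (f^a / c)^b = f^(a b) / c^b and the constant leaves the
   integral. The point to settle is that 0 < c < +oo. *)
Require Import Defs.
From HB Require Import structures.
From mathcomp Require Import all_boot all_order all_algebra.
From mathcomp Require Import all_classical all_reals all_analysis.
From mathcomp Require Import measurable_realfun.
Set Implicit Arguments.
Unset Strict Implicit.
Unset Printing Implicit Defensive.
Import Order.TTheory GRing.Theory Num.Theory.
Import numFieldNormedType.Exports.
Local Open Scope classical_set_scope.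
Local Open Scope ring_scope.
Local Open Scope ereal_scope.

Section densities.
Context {R : realType}.
Local Notation mu := (@lebesgue_measure R).

Lemma pdfP d (T : measurableType d) (P : probability T R) (X : {RV P >-> R})
  (f : R -> R) : has_density X f -> has_density X (pdf X).
Proof. by move=> Xf; apply: (@xgetPex _ _ [set g | has_density X g]); exists f. Qed.

(** Non-negativity removes the absolute value, and what remains is the total mass 1 of the
    distribution of [X]. *)
Lemma has_density_integrable d (T : measurableType d) (P : probability T R)
  (X : {RV P >-> R}) (f : R -> R) :
  has_density X f -> mu.-integrable setT (EFin \o f).
Proof.
move=> [mf f0 Xf]; apply/integrableP; split; first exact/measurable_EFinP.
under eq_integral do rewrite /= ger0_norm//.
by rewrite -Xf// probability_setT ltry.
Qed.

(** Over every measurable set both functions integrate to the same probability; by integrability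
    this forces equality almost everywhere. *)
Lemma has_density_unique d (T : measurableType d) (P : probability T R)
  (X : {RV P >-> R}) (f g : R -> R) :
  has_density X f -> has_density X g -> ae_eq mu setT f g.
Proof.
move=> Xf Xg; have [mg _ Xg_int] := Xg; have [_ _ Xf_int] := Xf.
have : ae_eq mu setT (EFin \o f) (EFin \o g).
  apply: integral_ae_eq => //.
  - exact: has_density_integrable Xf.
  - exact/measurable_EFinP.
  - by move=> E _ mE; rewrite -Xf_int// -Xg_int.
by apply: filterS => u /= + _ => /(_ I) [].
Qed.

Lemma measurable_weighted_powR (w f : R -> R) (p : R) :
  measurable_fun (`]0%R, +oo[ : set R) w -> measurable_fun [set: R] f ->
  measurable_fun (`]0%R, +oo[ : set R) (fun u => w u * f u `^ p)%R.
Proof.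
move=> mw mf; apply: measurable_funM => //.
apply: (measurableT_comp (measurable_powR p)).
exact: measurable_funTS.
Qed.

(** Frees the computation from the density picked by [pdf]: any other density agrees with it almost
    everywhere, hence so do the weighted powers. *)
Lemma gwigf_density d (T : measurableType d) (P : probability T R)
  (X : {RV P >-> R}) (f w : R -> R) (p : R) :
  measurable_fun (`]0%R, +oo[ : set R) w -> has_density X f ->
  gwigf X w p = \int[mu]_(u in `]0%R, +oo[) (w u * f u `^ p)%:E.
Proof.
move=> mw Xf; have XX := pdfP Xf.
have [mf _ _] := Xf; have [mX _ _] := XX.
apply: ae_eq_integral => //.
- by apply/measurable_EFinP; exact: measurable_weighted_powR.
- by apply/measurable_EFinP; exact: measurable_weighted_powR.
- by have := has_density_unique XX Xf; apply: filterS => u /= XfE _; rewrite XfE.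
Qed.

Lemma igf_gwigf d (T : measurableType d) (P : probability T R)
  (X : {RV P >-> R}) (p : R) : igf X p = gwigf X (cst 1%R) p.
Proof. by apply: eq_integral => u _; rewrite mul1r. Qed.

Lemma igf_density d (T : measurableType d) (P : probability T R)
  (X : {RV P >-> R}) (f : R -> R) (p : R) :
  has_density X f -> igf X p = \int[mu]_(u in `]0%R, +oo[) (f u `^ p)%:E.
Proof.
move=> Xf; rewrite igf_gwigf (gwigf_density _ _ Xf)//.
by apply: eq_integral => u _; rewrite mul1r.
Qed.

Lemma igf_ge0 d (T : measurableType d) (P : probability T R)
  (X : {RV P >-> R}) (p : R) : 0 <= igf X p.
Proof. by apply: integral_ge0 => u _; rewrite lee_fin powR_ge0. Qed.

(* If the normalising integral vanished, the convention [x / 0 = 0] would make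
   the escort density identically zero, whereas it has total mass 1. *)
Lemma escort_normalizer_neq0 d (T : measurableType d) (P : probability T R)
  (Y : {RV P >-> R}) (f : R -> R) (a : R) :
  is_escort Y f a ->
  fine (\int[mu]_(v in `]0%R, +oo[) (f v `^ a)%:E) != 0%R.
Proof.
move=> [_ _ /(_ setT measurableT)]; rewrite probability_setT => Y1.
apply/eqP => I0; have /eqP := Y1; rewrite integral0_eq ?onee_eq0// => u _.
by rewrite /escort_density I0 invr0 mulr0 if_same.
Qed.

End densities.

Theorem theorem4p1 (R : realType)
    (d : measure_display) (T : measurableType d) (P : probability T R)
    (X : {RV P >-> R}) (f : R -> R)
    (d' : measure_display) (T' : measurableType d') (Q : probability T' R)
    (Y : {RV Q >-> R})
    (w : R -> R) (alpha beta : R)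
    (X_ge0 : {ae P, forall t, (0 <= X t)%R})
    (X_density : has_density X f)
    (w_meas : measurable_fun (`]0%R, +oo[ : set R) w)
    (w_ge0 : forall u, (0 < u)%R -> (0 <= w u)%R)
    (alpha_gt0 : (0 < alpha)%R) (beta_ge1 : (1 <= beta)%R)
    (Y_escort : is_escort Y f alpha)
    (igf_fin : igf X alpha < +oo)
    (gwigf_fin : gwigf X w (alpha * beta)%R < +oo) :
  gwigf Y w beta = gwigf X w (alpha * beta)%R / igf X alpha `^ beta.
Proof.
have I_neq0 := escort_normalizer_neq0 Y_escort.
have [mf f_ge0 _] := X_density.
have I_ge0 := igf_ge0 X alpha.
rewrite (gwigf_density _ w_meas Y_escort) (gwigf_density _ w_meas X_density).
(* Finiteness makes [c] below the true value of the integral rather than the default 0 that [fine]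
   gives at infinity. *)
have I_fin : igf X alpha \is a fin_num by rewrite ge0_fin_numE.
move: I_neq0; rewrite -(igf_density _ X_density) => I_neq0.
set c := fine (igf X alpha) in I_neq0.
have c_ge0 : (0 <= c)%R by exact: fine_ge0.
have c_gt0 : (0 < c)%R by rewrite lt_def I_neq0.
(* In the extended reals the inverse of 0 is [+oo]; positivity of [c] selects the branch where the
   inverse is the real one. *)
rewrite -(fineK I_fin) -/c poweR_EFin inver gt_eqF ?powR_gt0// muleC.
(* The constant enters the integral by non-negativity of the integrand on [u > 0]. *)
rewrite -ge0_integralZl//; last 3 first.
- by apply/measurable_EFinP; exact: measurable_weighted_powR.
- move=> u; rewrite /= in_itv/= andbT => u_gt0.
  by rewrite lee_fin mulr_ge0 ?w_ge0 ?powR_ge0.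
- by rewrite lee_fin invr_ge0 powR_ge0.
apply: eq_integral => u; rewrite inE/= in_itv/= andbT => u_gt0.
rewrite /escort_density u_gt0 -(igf_density _ X_density) -/c -EFinM.
(* Writing the inverse of [c] as the power of exponent -1 lets it commute with the exponent
   [beta]. *)
rewrite powRM ?powR_ge0 ?invr_ge0// -powRrM -(powR_inv1 c_ge0) powRAC.
by rewrite powR_inv1 ?powR_ge0// mulrA mulrC.
Qed.
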